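(* For all integers $N\geq 2$ and all real $s>1$, there exists $\beta_0\in(0,1)$ such that if $E\subset\mathbb{R}^N$ is bounded and $$S^{s,+}_E:=\sum_{\substack{Q\in\Delta(\mathbb{R}^N)\\ \beta_E(3Q)\geq\beta_0}}(\operatorname{diam} Q)^s<\infty,$$ then $E$ is contained in a $(1/s)$-Hölder curve. More precisely, there is a constant $C$ depending only on $N$ and $s$ such that for every such $E$ we have $E\subset\Gamma=f([0,1])$ for some map $f:[0,1]\to\mathbb{R}^N$ satisfying $|f(x)-f(y)|\leq H|x-y|^{1/s}$ for all $x,y\in[0,1]$, with $H\leq C\left(\operatorname{diam}E+(\operatorname{diam}E)^{1-s}S^{s,+}_E\right)$.
   Context: $\Delta(\mathbb{R}^N)$ is the family of dyadic cubes $[2^k m_1,2^k(m_1+1)]\times\cdots\times[2^k m_N,2^k(m_N+1)]$ with $m_1,\dots,m_N,k\in\mathbb{Z}$. For a cube $Q$ and $\lambda>0$, $\lambda Q$ is the concentric dilate of $Q$ by the factor $\lambda$. For a nonempty set $E\subset\mathbb{R}^N$ and a bounded set $Q\subset\mathbb{R}^N$ of positive diameter, the Jones beta number is $$\beta_E(Q):=\inf_{\ell}\sup_{x\in E\cap Q}\frac{\operatorname{dist}(x,\ell)}{\operatorname{diam}Q}\in[0,1]$$ if $E\cap Q\neq\emptyset$, where $\ell$ ranges over all straight lines in $\mathbb{R}^N$, and $\beta_E(Q):=0$ if $E\cap Q=\emptyset$. A $(1/s)$-Hölder curve in $\mathbb{R}^N$ is the image of a map $f:[0,1]\to\mathbb{R}^N$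 with $|f(x)-f(y)|\leq H|x-y|^{1/s}$ for all $x,y\in[0,1]$ and some finite constant $H$. Sets $E$ are assumed nonempty; if $\operatorname{diam}E=0$, then $S_E^{s,+}=0$ and the product $(\operatorname{diam}E)^{1-s}S_E^{s,+}$ is read as $0$. *)

(* Defs.v *)
From mathcomp Require Import all_boot all_order all_algebra.
From mathcomp Require Import all_classical all_reals all_analysis.

Set Implicit Arguments.
Unset Strict Implicit.
Unset Printing Implicit Defensive.

Import Order.TTheory GRing.Theory Num.Theory.
Import numFieldNormedType.Exports.

Local Open Scope classical_set_scope.
Local Open Scope ring_scope.

Section Defs.
Context {R : realType} {N : nat}.
Implicit Types (x c : 'rV[R]_N) (A L E Q : set 'rV[R]_N).

(* The library norm `|x| on 'rV[R]_N is the sup norm, hence a separate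
   Euclidean norm. *)
Definition enorm x : R := Num.sqrt (\sum_(i < N) x 0 i ^+ 2).

(* Meaningful for nonempty bounded A (real sup). *)
Definition diam A : R := sup [set enorm (p.1 - p.2) | p in A `*` A].

Definition dist x L : R := inf [set enorm (x - y) | y in L].

Definition is_line L : Prop :=
  exists p v : 'rV[R]_N, v != 0 /\ L = [set p + t *: v | t in [set: R]].

Definition beta E Q : R :=
  if `[< E `&` Q !=set0 >]
  then inf [set sup [set dist x L / diam Q | x in E `&` Q] | L in is_line]
  else 0.

(* A dyadic cube is represented by its scale k and its integer vector m.
   For N > 0 distinct indices give distinct cubes, so that a sum over indices
   is a sum over the family of dyadic cubes. *)
Definition dyadic : Type := (int * 'rV[int]_N)%type.

Definition cube (q : dyadic) : set 'rV[R]_N :=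
  [set x | forall i : 'I_N,
     2 ^ q.1 * (q.2 0 i)%:~R <= x 0 i <= 2 ^ q.1 * (q.2 0 i + 1)%:~R].

Definition center (q : dyadic) : 'rV[R]_N :=
  \row_i (2 ^ q.1 * ((q.2 0 i)%:~R + 2^-1)).

Definition dilate (lambda : R) (q : dyadic) : set 'rV[R]_N :=
  [set center q + lambda *: (x - center q) | x in cube q].

Definition Splus (s beta0 : R) E : \bar R :=
  \esum_(q in [set q : dyadic | beta0 <= beta E (dilate 3 q)])
    (diam (cube q) `^ s)%:E.

(* f is total on R; only its values on [0, 1] matter. *)
Definition holder_on01 (a H : R) (f : R -> 'rV[R]_N) : Prop :=
  forall x y : R, x \in `[0, 1] -> y \in `[0, 1] ->
    enorm (f x - f y) <= H * `|x - y| `^ a.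

End Defs.

(* Main.v *)
Require Import Defs.
From mathcomp Require Import all_boot all_order all_algebra.
From mathcomp Require Import all_classical all_reals all_analysis.
From mathcomp Require Import ring lra zify.
Import Order.TTheory GRing.Theory Num.Theory.
Import numFieldNormedType.Exports.
Local Open Scope classical_set_scope.
Local Open Scope ring_scope.

Set Implicit Arguments.
Unset Strict Implicit.
Unset Printing Implicit Defensive.

(** Write d for the diameter of E. Fix M = 2 ^ J and consider the tree of the
    dyadic cubes of side 2 ^ k / M ^ n, n = 0, 1, 2, and so on, that meet E,
    where 2 ^ k is comparable to d. Give each cube of side l the weight
    l ^ s.

    The total weight of the tree is at most a constant times d ^ s + S, where
    S is the sum of (diam Q) ^ s over the non-flat cubes Q [tree_mass]. Indeed,
    if beta_E(3Q) is small in comparison with 1 / M, then E meets Q inside a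
    tube around a line, whose radius is the side of the subcubes, and so Q has
    at most 6 ^ N * M children [flat_children]. Their total weight is at most
    6 ^ N * M ^ (1 - s) times the weight of Q, and since s > 1 this factor is at
    most 1 / 2 for J large [flat_scale]. A non-flat cube has at most M ^ N
    children, whose weight is paid for by the term of Q in S.

    Order E lexicographically along the tree, and send x in E to the total
    weight tau x of the cubes of the tree that lie entirely before x. If x and y
    are first separated by cubes of side l, then |tau x - tau y| >= l ^ s
    [tree_coding] while |x - y| is at most a constant times l
    [separated_by_level]. Hence
    |x - y| <= c * |tau x - tau y| ^ (1 / s): the inverse of tau is
    (1 / s)-Hölder on a subset of an interval whose length is the weight of the
    tree. McShane's formula, applied to each coordinate, extends it to the whole
    interval [holder_curve], and rescaling the interval to [0, 1] gives f. The
    resulting constant is W ^ (1 / s), up to a factor, with W the weight of the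
    tree, and (d ^ s + S) ^ (1 / s) <= d + d ^ (1 - s) * S
    [holder_bound]. *)

(** * Euclidean norm, diameters and lines *)

Lemma coord_le_enorm (R : realType) (N : nat) (x : 'rV[R]_N) (i : 'I_N) :
  `|x 0 i| <= enorm x.
Proof.
rewrite /enorm -sqrtr_sqr ler_wsqrtr // (bigD1 i) //= lerDl.
by apply: sumr_ge0 => j _; rewrite sqr_ge0.
Qed.

Lemma enorm_le (R : realType) (N : nat) (x : 'rV[R]_N) (c : R) :
  (forall i, `|x 0 i| <= c) -> enorm x <= N%:R * c.
Proof.
move=> xc; rewrite /enorm.
have c0 : 0 <= N%:R * c.
  case: N x xc => [|n] x xc; first by rewrite mul0r.
  by rewrite mulr_ge0 // (le_trans _ (xc ord0)).
rewrite -[leRHS]ger0_norm // -sqrtr_sqr ler_wsqrtr //.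
apply: (@le_trans _ _ (\sum_(i < N) c ^+ 2)).
  apply: ler_sum => i _; rewrite -real_normK ?num_real //.
  by rewrite lerXn2r ?nnegrE // (le_trans _ (xc i)).
rewrite sumr_const card_ord -[leLHS]mulr_natl exprMn ler_wpM2r ?sqr_ge0 //.
by rewrite -natrX ler_nat; case: (N) => // n; rewrite -mulnn leq_pmulr.
Qed.

Lemma enorm_sub_le_diam (R : realType) (N : nat) (A : set 'rV[R]_N) (c : R)
    (x y : 'rV[R]_N) :
  (forall a b, A a -> A b -> forall i, `|a 0 i - b 0 i| <= c) ->
  A x -> A y -> enorm (x - y) <= diam A.
Proof.
move=> Ac Ax Ay; apply: ub_le_sup; last by exists (x, y).
exists (N%:R * c) => _ [[a b] [/= Aa Ab] <-].
by apply: enorm_le => i; rewrite !mxE; apply: Ac.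
Qed.

Lemma diam_le (R : realType) (N : nat) (A : set 'rV[R]_N) (c : R) :
  A !=set0 ->
  (forall a b, A a -> A b -> forall i, `|a 0 i - b 0 i| <= c) ->
  diam A <= N%:R * c.
Proof.
move=> [x Ax] Ac; apply: ge_sup; first by exists (enorm (x - x)), (x, x).
move=> _ [[a b] [/= Aa Ab] <-].
by apply: enorm_le => i; rewrite !mxE; apply: Ac.
Qed.

(** If the beta number is less than b, then the points of E in Q lie in a tube
    of radius b * diam Q around some line. *)
Lemma beta_lt_line (R : realType) (N : nat) (E Q : set 'rV[R]_N) (b c : R) :
  (0 < N)%N ->
  (forall x y, Q x -> Q y -> forall i, `|x 0 i - y 0 i| <= c) ->
  0 < diam Q -> E `&` Q !=set0 -> beta E Q < b ->
  exists p v : 'rV[R]_N, v != 0 /\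
    forall x, E x -> Q x ->
      exists t, enorm (x - (p + t *: v)) < b * diam Q.
Proof.
move=> N0 Qc dQ EQ; rewrite /beta asboolT // => /inf_lt[].
  exists (sup [set dist x [set 0 + t *: const_mx 1 | t in [set: R]] / diam Q
            | x in E `&` Q]).
  exists [set 0 + t *: const_mx 1 | t in [set: R]] => //.
  exists 0, (const_mx 1); split => //.
  apply/eqP => /matrixP /(_ 0 (Ordinal N0)); rewrite !mxE => /eqP.
  by rewrite oner_eq0.
move=> _ [L [p [v [v0 ->]]] <-] supb; exists p, v; split => // x Ex Qx.
have distle y : dist y [set p + t *: v | t in [set: R]] <= enorm (y - p).
  apply: ge_inf; first by exists 0 => _ [z _ <-]; rewrite sqrtr_ge0.
  by exists p => //; exists 0 => //; rewrite scale0r addr0.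
have : dist x [set p + t *: v | t in [set: R]] / diam Q < b.
  apply: le_lt_trans supb; apply: ub_le_sup; last by exists x.
  exists (N%:R * (c + enorm (x - p)) / diam Q) => _ [y [Ey Qy] <-].
  rewrite ler_wpM2r ?invr_ge0 ?(ltW dQ) // (le_trans (distle _)) //.
  apply: enorm_le => i.
  rewrite [_ i](_ : _ = (y 0 i - x 0 i) + (x - p) 0 i); last first.
    by rewrite !mxE; ring.
  by rewrite (le_trans (ler_normD _ _)) // lerD ?coord_le_enorm ?Qc.
rewrite ltr_pdivrMr // => /inf_lt[].
  by exists (enorm (x - p)), p => //; exists 0 => //; rewrite scale0r addr0.
by move=> _ [_ [t _ <-] <-] xb; exists t.
Qed.

(** * Dyadic cubes *)

Lemma cube_coord (R : realType) (N : nat) (q : dyadic) (x y : 'rV[R]_N) :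
  cube q x -> cube q y -> forall i, `|x 0 i - y 0 i| <= 2 ^ q.1.
Proof.
move=> qx qy i; have := qx i; have := qy i.
rewrite intrD; set a := 2 ^ q.1; rewrite mulrDr mulr1; set b := a * _.
by move=> /andP[? ?] /andP[? ?]; rewrite ler_norml; apply/andP; split; lra.
Qed.

Lemma dilate_coord (R : realType) (N : nat) (q : dyadic) (c : R)
    (x y : 'rV[R]_N) :
  0 <= c -> dilate c q x -> dilate c q y ->
  forall i, `|x 0 i - y 0 i| <= c * 2 ^ q.1.
Proof.
move=> c0 [a qa <-] [b qb <-] i; have := cube_coord qa qb i => ab.
rewrite !mxE; set z := (X in `|X|).
have -> : z = c * (a 0 i - b 0 i) by rewrite /z; ring.
by rewrite normrM ger0_norm // ler_wpM2l.
Qed.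

(** The lower corner of a cube moved by t, a fraction of its side, in the
    direction of the i-th axis. *)
Definition edge_point (R : realType) (N : nat) (q : dyadic) (i : 'I_N)
  (t : R) : 'rV[R]_N :=
  \row_j (2 ^ q.1 * ((q.2 0 j)%:~R + (if j == i then t else 0))).

Lemma cube_edge_point (R : realType) (N : nat) (q : dyadic) (i : 'I_N)
    (t : R) :
  0 <= t <= 1 -> cube q (edge_point q i t).
Proof.
move=> t01 j; rewrite mxE intrD.
have k0 : (0 : R) < 2 ^ q.1 by rewrite exprz_gt0.
by rewrite !ler_pM2l //; case: ifP => _; lra.
Qed.

Lemma cube_sub_dilate3 (R : realType) (N : nat) (q : dyadic) :
  @cube R N q `<=` dilate 3 q.
Proof.
move=> x qx; pose z : 'rV[R]_N := Defs.center q.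
exists (z + 3^-1 *: (x - z)); last first.
  by apply/rowP => i; rewrite /z !mxE; field.
move=> i; have := qx i; rewrite /z !mxE intrD.
set a := 2 ^ q.1; rewrite !mulrDr mulr1; set b := a * _.
by move=> /andP[? ?]; apply/andP; split; lra.
Qed.

Lemma diam_cube_ge (R : realType) (N : nat) (q : dyadic) :
  (0 < N)%N -> 2 ^ q.1 <= diam (@cube R N q).
Proof.
move=> N0; pose i := Ordinal N0.
apply: le_trans (enorm_sub_le_diam (@cube_coord R N q)
  (@cube_edge_point R N q i 1 _) (@cube_edge_point R N q i 0 _)); last 2 first.
- by lra.
- by lra.
apply: le_trans (coord_le_enorm _ i); rewrite !mxE eqxx.
rewrite (_ : _ - _ = 2 ^ q.1); last by ring.
by rewrite ler_norm.
Qed.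

Lemma diam_dilate3 (R : realType) (N : nat) (q : dyadic) :
  (0 < N)%N ->
  0 < diam (@dilate R N 3 q) <= N%:R * (3 * 2 ^ q.1).
Proof.
move=> N0; apply/andP; split; last first.
  apply: diam_le; last by move=> a b; apply: dilate_coord.
  exists (edge_point q (Ordinal N0) 0); apply: cube_sub_dilate3.
  by apply: cube_edge_point; lra.
have ge3 : (0 : R) <= 3 by rewrite ler0n.
pose i := Ordinal N0; pose e t : 'rV[R]_N := edge_point q i t.
have De t : 0 <= t <= 1 -> dilate 3 q (e t).
  by move=> t01; apply: cube_sub_dilate3; apply: cube_edge_point.
have k0 : (0 : R) < 2 ^ q.1 by rewrite exprz_gt0.
apply: lt_le_trans (enorm_sub_le_diam (fun a b => dilate_coord ge3)
  (De 1 _) (De 0 _)); last 2 first.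
- by lra.
- by lra.
apply: lt_le_trans (coord_le_enorm _ i); rewrite !mxE eqxx.
rewrite (_ : _ - _ = 2 ^ q.1); last by ring.
by rewrite normr_gt0 gt_eqF.
Qed.

(** * Indices of dyadic cubes *)

(** The index of the half-open dyadic cube of side 2 ^ k that contains x. *)
Definition grid_index (R : realType) (N : nat) (k : int) (x : 'rV[R]_N) :
  'rV[int]_N := \row_j Num.floor (x 0 j / 2 ^ k).

Lemma cube_grid_index (R : realType) (N : nat) (k : int) (x : 'rV[R]_N) :
  cube (k, grid_index k x) x.
Proof.
move=> i; rewrite mxE /=; have k0 : (0 : R) < 2 ^ k by rewrite exprz_gt0.
have /andP[] := floor_itv (x 0 i / 2 ^ k).
rewrite ler_pdivlMr // ltr_pdivrMr // => h1 /ltW h2.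
by rewrite mulrC h1 mulrC h2.
Qed.

(** The index of the cube, of M times the side, that contains the cube of
    index u; this is a dyadic cube when M is a power of 2. *)
Definition parent (N : nat) (M : nat) (u : 'rV[int]_N) : 'rV[int]_N :=
  \row_j (u 0%R j %/ M%:Z)%Z.

Lemma floor_divn (R : realType) (y : R) (M : nat) :
  (0 < M)%N -> Num.floor (y / M%:R) = (Num.floor y %/ M%:Z)%Z.
Proof.
move=> M0; have M0' : (0 : R) < M%:R by rewrite ltr0n.
have Mz : 0 < M%:Z by [].
apply: floor_def; rewrite ler_pdivlMr // ltr_pdivrMr //.
have -> : (M%:R : R) = M%:Z%:~R by rewrite -pmulrn.
rewrite -!intrM -floor_ge_int lez_floor ?gt_eqF //=.
apply: lt_le_trans (lt_succ_floor _) _; rewrite ler_int lezD1.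
exact: ltz_ceil.
Qed.

Lemma parent_grid_index (R : realType) (N : nat) (k : int) (J : nat)
    (x : 'rV[R]_N) :
  parent (2 ^ J) (grid_index k x) = grid_index (k + J%:Z) x.
Proof.
apply/rowP => j; rewrite !mxE -floor_divn ?expn_gt0 //; congr Num.floor.
by rewrite expfzDr ?pnatr_eq0 // invfM mulrA natrX.
Qed.

Lemma floor_dist (R : realType) (a b : R) (n : nat) :
  `|a - b| <= n%:R -> `|Num.floor a - Num.floor b| < n.+1%:Z.
Proof.
have -> : (n%:R : R) = n%:Z%:~R by rewrite -pmulrn.
rewrite ler_norml => /andP[h1 h2].
have /andP[a1 a2] := floor_itv a; have /andP[b1 b2] := floor_itv b.
rewrite intrD in a2; rewrite intrD in b2.
rewrite ltr_norml -addn1 PoszD.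
by apply/andP; split; rewrite -(ltr_int R) ?intrN !intrD intrN; lra.
Qed.

Lemma parent_close (N : nat) (M : nat) (u v : 'rV[int]_N) :
  (0 < M)%N -> parent M u = parent M v ->
  forall j, `|u 0 j - v 0 j| < M%:Z.
Proof.
move=> M0 uv j; move/rowP/(_ j): uv; rewrite !mxE => uv.
have Mz : 0 < M%:Z by [].
have := divz_eq (u 0 j) M; have := divz_eq (v 0 j) M; rewrite -uv.
have := modz_ge0 (u 0 j) (lt0r_neq0 Mz); have := ltz_pmod (u 0 j) Mz.
have := modz_ge0 (v 0 j) (lt0r_neq0 Mz); have := ltz_pmod (v 0 j) Mz.
lia.
Qed.

(** ** Counting indices *)

(** The residue of z modulo D.+1; the successor keeps the type 'I_D.+1
    inhabited. *)
Definition residue (D : nat) (z : int) : 'I_D.+1 := inord `|(z %% D.+1)%Z|%N.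

Lemma residue_inj (D : nat) (a b : int) :
  `|a - b| < D.+1%:Z -> residue D a = residue D b -> a = b.
Proof.
move=> ab; have D0 : 0 < D.+1%:Z by [].
have ha := modz_ge0 a (lt0r_neq0 D0); have ha' := ltz_pmod a D0.
have hb := modz_ge0 b (lt0r_neq0 D0); have hb' := ltz_pmod b D0.
move=> /(congr1 val); rewrite /= !inordK; [|lia|lia].
move=> e; have {e} e : (a %% D.+1)%Z = (b %% D.+1)%Z by lia.
have := divz_eq a D.+1; have := divz_eq b D.+1; rewrite e.
set x := (a %/ _)%Z; set y := (b %/ _)%Z => ea eb.
have : x = y by nia.
by lia.
Qed.

Lemma size_le_card (T : eqType) (F : finType) (f : T -> F) (s : seq T) :
  uniq s -> {in s &, injective f} -> (size s <= #|F|)%N.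
Proof.
move=> us fi; rewrite -(size_map f).
have /card_uniqP <- : uniq (map f s) by rewrite map_inj_in_uniq.
exact: max_card.
Qed.

Lemma size_close (N D : nat) (s : seq 'rV[int]_N) :
  uniq s -> (0 < D)%N ->
  (forall u v, u \in s -> v \in s -> forall j, `|u 0 j - v 0 j| < D%:Z) ->
  (size s <= D ^ N)%N.
Proof.
case: D => // D us _ close.
pose f (u : 'rV[int]_N) := [ffun j => residue D (u 0 j)].
apply: leq_trans (@size_le_card _ _ f s us _) _; last first.
  by rewrite card_ffun !card_ord.
move=> u v us' vs /ffunP e; apply/rowP => j.
by move: (e j); rewrite !ffunE; apply: residue_inj; apply: close.
Qed.

(** Indices that are determined up to few choices by one coordinate. *)
Lemma size_close_fiber (N D M : nat) (i : 'I_N) (s : seq 'rV[int]_N) :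
  uniq s -> (0 < D)%N -> (0 < M)%N ->
  (forall u v, u \in s -> v \in s -> `|u 0 i - v 0 i| < M%:Z) ->
  (forall u v, u \in s -> v \in s -> u 0 i = v 0 i ->
    forall j, `|u 0 j - v 0 j| < D%:Z) ->
  (size s <= M * D ^ N)%N.
Proof.
case: D M => // D [] // M us _ _ closei close.
pose f (u : 'rV[int]_N) :=
  (residue M (u 0 i), [ffun j => residue D (u 0 j)]).
apply: leq_trans (@size_le_card _ _ f s us _) _; last first.
  by rewrite card_prod card_ffun !card_ord.
move=> u v us' vs [] /residue_inj e1 /ffunP e2.
have {}e1 := e1 (closei _ _ us' vs).
apply/rowP => j; move: (e2 j); rewrite !ffunE.
by apply: residue_inj; apply: close.
Qed.

Lemma finite_set_size (T : choiceType) (A : set T) (n : nat) :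
  (forall s : seq T, uniq s -> (forall x, x \in s -> A x) ->
    (size s <= n)%N) ->
  finite_set A.
Proof.
move=> An; apply: contrapT => /(infinite_set_fset n.+1)[B BA nB].
have := An (finmap.enum_fset B) (finmap.fset_uniq B) BA.
by rewrite leqNgt nB.
Qed.

Lemma size_fibers (T U : eqType) (f : T -> U) (s : seq T) (V : seq U) :
  uniq V -> (forall u, u \in s -> f u \in V) ->
  size s = (\sum_(t <- V) size [seq u <- s | f u == t])%N.
Proof.
move=> uV; elim: s => [|a s IH] sV.
  by rewrite big1_seq.
rewrite /= IH => [|u us]; last by rewrite sV // inE us orbT.
rewrite [RHS](eq_bigr (fun t => ((f a == t) + size [seq u <- s | f u == t])%N)).
  rewrite big_split /= -[in LHS]add1n; congr addn.
  rewrite (bigD1_seq (f a)) ?sV ?mem_head //= eqxx big1 ?addn0 // => t.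
  by rewrite eq_sym => /negPf ->.
by move=> t _; case: eqP.
Qed.

(** The cubes of side 2 ^ k that contain a point at distance less than 2 ^ k
    from a line are determined, up to boundedly many choices, by the i-th
    coordinate of their index, where i is the steepest direction of the line. *)
Lemma tube_grid_index_close (R : realType) (N : nat) (k : int)
    (x y p v : 'rV[R]_N) (t u : R) (i : 'I_N) :
  (forall j, `|v 0 j| <= `|v 0 i|) ->
  enorm (x - (p + t *: v)) < 2 ^ k ->
  enorm (y - (p + u *: v)) < 2 ^ k ->
  grid_index k x 0 i = grid_index k y 0 i ->
  forall j, `|grid_index k x 0 j - grid_index k y 0 j| < 6%:Z.
Proof.
move=> vi xt yu xy j.
have k0 : (0 : R) < 2 ^ k by rewrite exprz_gt0.
have hx l := le_lt_trans (coord_le_enorm _ l) xt.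
have hy l := le_lt_trans (coord_le_enorm _ l) yu.
move: {xt yu} (hx i) (hx j) (hy i) (hy j); rewrite !mxE.
have {hx} := @cube_grid_index R N k x i.
have {hy} := @cube_grid_index R N k y i.
rewrite /= -xy intrD; set r := 2 ^ k in k0 *.
rewrite mulrDr mulr1; set b := r * _ => /andP[? ?] /andP[? ?].
have tuv : `|(t - u) * v 0 j| <= `|(t - u) * v 0 i|.
  by rewrite !normrM ler_wpM2l.
(* The parameters t and u are so close that the line moves by at most 3 * r in
   each coordinate, and x and y are at distance less than r from it. *)
move=> hxi hxj hyi hyj; apply: (@floor_dist _ _ _ 5).
rewrite -mulrBl normrM normfV (gtr0_norm k0) ler_pdivrMr //.
move: hxi hxj hyi hyj; rewrite !ltr_norml.
move=> /andP[? ?] /andP[? ?] /andP[? ?] /andP[? ?].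
have : `|(t - u) * v 0 i| <= 3 * r.
  by rewrite ler_norml mulrBl; apply/andP; split; lra.
move=> /(le_trans tuv); rewrite ler_norml mulrBl => /andP[? ?].
by rewrite ler_norml; apply/andP; split; lra.
Qed.

(** * Coding the leaves of a weighted tree by real numbers *)

Lemma ltn_count (T : eqType) (a b : pred T) (s : seq T) (x : T) :
  subpred a b -> x \in s -> b x -> ~~ a x -> (count a s < count b s)%N.
Proof.
move=> ab; elim: s => //= y s IH; rewrite inE => /orP[/eqP <- bx nax|xs bx nax].
  by rewrite bx (negPf nax) add0n add1n ltnS sub_count.
rewrite -addnS leq_add ?IH //.
by case ay: (a y); rewrite ?(ab _ ay).
Qed.

(** The points of E are the ends of a tree: q n x is the node of level n
    below which x lies. If the tree carries a weight w n on each node of level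
    n, of finite total, then its ends can be placed on a bounded interval so
    that two ends with distinct nodes of level n are w n apart: order the ends
    lexicographically, and send x to the total weight of the nodes that lie
    entirely before x. *)
Lemma tree_coding (R : realType) (X : Type) (E : set X) (T : countType)
    (q : nat -> X -> T) (w : nat -> R) (V : nat -> seq T) (W : R) :
  (forall n, 0 <= w n) ->
  (forall n x, E x -> q n x \in V n) ->
  (forall n x y, q n.+1 x = q n.+1 y -> q n x = q n y) ->
  (forall L, \sum_(0 <= n < L) (size (V n))%:R * w n <= W) ->
  exists tau : X -> R, (forall x, 0 <= tau x <= W) /\
    (forall n x y, E x -> E y -> q n x <> q n y -> w n <= `|tau x - tau y|).
Proof.
move=> w0 qV qS VW.
have q_le n m x y : (m <= n)%N -> q n x = q n y -> q m x = q m y.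
  elim: n => [|n IH]; first by rewrite leqn0 => /eqP ->.
  by rewrite leq_eqVlt ltnS => /orP[/eqP -> //|/IH h /qS].
pose lex x y j := (forall i, (i < j)%N -> q i x = q i y) /\
  (pickle (q j x) < pickle (q j y))%N.
pose before n t x := `[< exists y j, [/\ q n y = t, (j <= n)%N & lex y x j] >].
have lexT x y z i j : lex x y i -> lex y z j -> lex x z (minn i j).
  move=> [xy xyi] [yz yzj]; split => [k|].
    by rewrite leq_min => /andP[/xy -> /yz].
  case: (ltngtP i j) => [ij|ji|ij].
  - by rewrite -(yz _ ij).
  - by rewrite (xy _ ji).
  - by subst j; apply: ltn_trans yzj.
pose partial L x :=
  \sum_(0 <= n < L) (count (fun t => before n t x) (V n))%:R * w n.
have partial_ge0 L x : 0 <= partial L x.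
  by apply: sumr_ge0 => n _; rewrite mulr_ge0.
have partial_le L x : partial L x <= W.
  apply: le_trans (VW L); apply: ler_sum => n _.
  by rewrite ler_wpM2r // ler_nat count_size.
have partial_mono L K x : (L <= K)%N -> partial L x <= partial K x.
  move=> LK; rewrite /partial (big_cat_nat (n := L) (leq0n _) LK) /= lerDl.
  by apply: sumr_ge0 => n _; rewrite mulr_ge0.
pose tau x := sup [set partial L x | L in [set: nat]].
have tau_ge L x : partial L x <= tau x.
  apply: ub_le_sup; last by exists L.
  by exists W => _ [K _ <-].
have tau_le c x : (forall L, partial L x <= c) -> tau x <= c.
  move=> Lc; apply: ge_sup; first by exists (partial 0%N x), 0%N.
  by move=> _ [L _ <-].
(* If x comes before y, and they are separated at level n, then the node of x
   at level n is counted for y but not for x. *)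
have lex_tau n j x y : E x -> (j <= n)%N -> lex x y j ->
    tau x + w n <= tau y.
  move=> Ex jn xy; rewrite -lerBrDr; apply: tau_le => L.
  have nK : (n < maxn L n.+1)%N by rewrite leq_max leqnn orbT.
  rewrite lerBrDr; apply: le_trans (tau_ge (maxn L n.+1) y).
  apply: (@le_trans _ _ (partial (maxn L n.+1) x + w n)).
    by rewrite lerD2r partial_mono // leq_max leqnn.
  have bef m : subpred (fun t => before m t x) (fun t => before m t y).
    move=> t /asboolP[z [i [zt im zx]]]; apply/asboolP.
    by exists z, (minn i j); split; [|rewrite geq_min im|apply: lexT xy].
  rewrite /partial !(bigD1_seq n) ?mem_index_iota ?iota_uniq //=.
  rewrite addrAC lerD //; last first.
    by apply: ler_sum => m _; rewrite ler_wpM2r // ler_nat sub_count.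
  rewrite -[X in _ + X]mul1r -mulrDl natr1 ler_wpM2r // ler_nat.
  apply: (ltn_count (x := q n x)) => //; first exact: qV.
    by apply/asboolP; exists x, j.
  apply/asboolP => -[z [i [zx im [_]]]].
  by rewrite (q_le _ _ _ _ im zx) ltnn.
exists tau; split => [x|n x y Ex Ey /eqP xy].
  by rewrite tau_le // (le_trans _ (tau_ge 0%N x)).
have ex : exists j, q j x != q j y by exists n.
case: (ex_minnP ex) => j jxy jmin.
have jn : (j <= n)%N by apply: jmin.
have eqj i : (i < j)%N -> q i x = q i y.
  by move=> ij; apply/eqP; apply: contraTT ij => /jmin; rewrite -leqNgt.
case: (ltngtP (pickle (q j x)) (pickle (q j y))) => [l|l|/(pcan_inj pickleK)e].
- have := @lex_tau n j x y Ex jn (conj eqj l) => h.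
  by rewrite distrC (le_trans _ (ler_norm _)) // lerBrDl.
- have := @lex_tau n j y x Ey jn (conj (fun i h => esym (eqj i h)) l) => h.
  by rewrite (le_trans _ (ler_norm _)) // lerBrDl.
- by rewrite e eqxx in jxy.
Qed.

(** * Extension of Hölder functions *)

Lemma powR_subadd (R : realType) (a b r : R) :
  0 <= a -> 0 <= b -> r <= 1 -> (a + b) `^ r <= a `^ r + b `^ r.
Proof.
move=> a0 b0 r1; have [c0|c0] := eqVneq (a + b) 0.
  have -> : a = 0 by lra.
  by rewrite add0r lerDr powR_ge0.
have cp : 0 < a + b by rewrite lt_neqAle eq_sym c0 addr_ge0.
have part x : 0 <= x -> x <= a + b -> x / (a + b) * (a + b) `^ r <= x `^ r.
  move=> x0 xc; rewrite -{2}(divfK c0 x) powRM ?divr_ge0 ?(ltW cp) //.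
  rewrite ler_wpM2r ?powR_ge0 //.
  have [->|xn0] := eqVneq x 0; first by rewrite mul0r powR_ge0.
  rewrite ger1_powR // divr_gt0 /= ?ler_pdivrMr ?mul1r //.
  by rewrite lt_neqAle eq_sym xn0.
apply: le_trans (lerD (part a a0 _) (part b b0 _)); [|lra|lra].
by rewrite -mulrDl -mulrDl divff // mul1r.
Qed.

(** McShane's formula extends a Hölder function from a subset of the line, here
    parametrized by sigma, to the line with the same constant. *)
Lemma holder_extension (R : realType) (X : Type) (E : set X)
    (sigma g : X -> R) (H r : R) :
  E !=set0 -> 0 < r <= 1 -> 0 <= H ->
  (forall x y, E x -> E y -> `|g x - g y| <= H * `|sigma x - sigma y| `^ r) ->
  exists f : R -> R, (forall x, E x -> f (sigma x) = g x) /\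
    (forall s t, `|f s - f t| <= H * `|s - t| `^ r).
Proof.
move=> [x0 Ex0] /andP[r0 r1] H0 gH.
have tri (s t u : R) :
    H * `|s - u| `^ r <= H * `|s - t| `^ r + H * `|t - u| `^ r.
  rewrite -mulrDr ler_wpM2l //.
  apply: le_trans (powR_subadd (normr_ge0 _) (normr_ge0 _) r1).
  by rewrite (ge0_ler_powR (ltW r0)) ?nnegrE ?addr_ge0 ?ler_distD.
pose S t := [set g x + H * `|t - sigma x| `^ r | x in E].
have S0 t : S t !=set0 by exists (g x0 + H * `|t - sigma x0| `^ r), x0.
have lbS t x : E x -> lbound (S t) (g x - H * `|t - sigma x| `^ r).
  move=> Ex _ [y Ey <-]; have := gH _ _ Ex Ey; rewrite ler_norml => /andP[_].
  have := tri (sigma x) t (sigma y).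
  by rewrite (distrC (sigma x) t) => ? ?; lra.
have infS t x : E x -> inf (S t) <= g x + H * `|t - sigma x| `^ r.
  move=> Ex; apply: ge_inf; last by exists x.
  by exists (g x0 - H * `|t - sigma x0| `^ r); apply: lbS.
exists (fun t => inf (S t)); split => [x Ex|s t].
  have := infS (sigma x) x Ex; have := lb_le_inf (S0 _) (lbS (sigma x) x Ex).
  by rewrite subrr normr0 powR0 ?gt_eqF // mulr0 addr0 subr0 => ? ?; lra.
have le u v : inf (S u) - H * `|u - v| `^ r <= inf (S v).
  apply: lb_le_inf => // _ [x Ex <-].
  by have := infS u x Ex; have := tri u v (sigma x); lra.
have := le s t; have := le t s; rewrite (distrC t s) ler_norml => ? ?.
by apply/andP; split; lra.
Qed.

(** A set which embeds in [0, 1] by a map with Hölder inverse lies on a Hölder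
    curve. *)
Lemma holder_curve (R : realType) (N : nat) (E : set 'rV[R]_N)
    (sigma : 'rV[R]_N -> R) (H r : R) :
  E !=set0 -> 0 < r <= 1 -> 0 <= H ->
  (forall x, E x -> 0 <= sigma x <= 1) ->
  (forall x y, E x -> E y ->
    forall i, `|x 0 i - y 0 i| <= H * `|sigma x - sigma y| `^ r) ->
  exists f : R -> 'rV[R]_N,
    holder_on01 r (N%:R * H) f /\ E `<=` f @` `[0, 1].
Proof.
move=> E0 r01 H0 s01 sH.
have ex i := holder_extension (g := fun x : 'rV[R]_N => x 0 i) E0 r01 H0
  (fun x y Ex Ey => sH x y Ex Ey i).
have [f fP] := choice ex.
exists (fun t => \row_i f i t); split => [s t _ _|x Ex].
  by rewrite -mulrA; apply: enorm_le => i; rewrite !mxE; case: (fP i).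
exists (sigma x); first by rewrite /= in_itv /= s01.
by apply/rowP => i; rewrite mxE; case: (fP i) => ->.
Qed.

(** * The tree of dyadic cubes that meet E *)

(** Flatness places the points of E in the cube in a tube around a line, whose
    radius is the side of the subcubes. The points of such a tube lie in at most
    6 ^ N * M of the M ^ N subcubes, M = 2 ^ J. *)
Lemma flat_children (R : realType) (N J : nat) (E : set 'rV[R]_N) (k : int)
    (m : 'rV[int]_N) (s : seq 'rV[int]_N) :
  (0 < N)%N ->
  beta E (dilate 3 (k, m)) < (3 * N%:R * (2 ^ J)%:R)^-1 -> uniq s ->
  (forall u, u \in s -> parent (2 ^ J) u = m /\
     exists2 x, E x & u = grid_index (k - J%:Z) x) ->
  (size s <= 2 ^ J * 6 ^ N)%N.
Proof.
move=> N0 flat us sE.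
have M0 : (0 < 2 ^ J)%N by rewrite expn_gt0.
have sub x : E x -> parent (2 ^ J) (grid_index (k - J%:Z) x) = m ->
    dilate 3 (k, m) x.
  move=> Ex; rewrite parent_grid_index subrK => <-.
  exact/cube_sub_dilate3/cube_grid_index.
have [->//|[u0 u0s]] : s = [::] \/ exists u, u \in s.
  by case: (s) => [|u r]; [left|right; exists u; rewrite mem_head].
have EQ : E `&` dilate 3 (k, m) !=set0.
  have [um [x Ex ux]] := sE u0 u0s.
  by exists x; split => //; apply: sub; rewrite -?ux.
have /andP[d0 dle] := @diam_dilate3 R N (k, m) N0.
have ge3 : (0 : R) <= 3 by rewrite ler0n.
have [p [v [_ pv]]] := beta_lt_line N0
  (fun x y => dilate_coord ge3) d0 EQ flat.
have tube x : E x -> dilate 3 (k, m) x ->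
    exists t, enorm (x - (p + t *: v)) < 2 ^ (k - J%:Z).
  move=> Ex /(pv x Ex)[t xt]; exists t; apply: (lt_le_trans xt).
  rewrite ler_pdivrMl; last by rewrite !mulr_gt0 ?ltr0n.
  apply: le_trans dle _; rewrite expfzDr ?pnatr_eq0 // -exprnN natrX /=.
  have J0 : (2 : R) ^+ J != 0 by rewrite expf_neq0 // pnatr_eq0.
  rewrite [leRHS](_ : _ = N%:R * (3 * 2 ^ k)) //.
  by rewrite mulrACA divff // mulr1 mulrCA mulrA.
have [i _ vi] := @arg_maxP _ _ 'I_N (Ordinal N0) xpredT
  (fun j => `|v 0 j|) isT.
apply: (size_close_fiber (i := i) us) => // [a b|a b] as_ bs.
  have [am _] := sE a as_; have [bm _] := sE b bs.
  by apply: parent_close => //; rewrite am.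
have [am [x Ex ax]] := sE a as_; have [bm [y Ey by_]] := sE b bs.
have [t xt] := tube x Ex (sub x Ex ltac:(by rewrite -ax)).
have [u yu] := tube y Ey (sub y Ey ltac:(by rewrite -by_)).
rewrite ax by_; apply: tube_grid_index_close xt yu => j.
exact: vi.
Qed.

Lemma grid_index_seq (R : realType) (N : nat) (E : set 'rV[R]_N) (k : int)
    (c : R) :
  (forall x y, E x -> E y -> forall i, `|x 0 i - y 0 i| <= c) ->
  exists V : seq 'rV[int]_N, uniq V /\
    forall u, u \in V <-> exists2 x, E x & u = grid_index k x.
Proof.
move=> Ec; have k0 : (0 : R) < 2 ^ k by rewrite exprz_gt0.
pose n := (Num.truncn (c / 2 ^ k)).+1.
have /finite_seqP[s sE] : finite_set [set grid_index k x | x in E].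
  apply: (@finite_set_size _ _ (n.+1 ^ N)) => s us sE.
  apply: size_close => // u v /sE[x Ex <-] /sE[y Ey <-] j.
  rewrite !mxE; apply: floor_dist; rewrite -mulrBl normrM normfV.
  rewrite (gtr0_norm k0) ler_pdivrMr //; apply: le_trans (Ec _ _ Ex Ey _) _.
  by rewrite -ler_pdivrMr // ltW // truncnS_gt.
exists (undup s); split => [|u]; first exact: undup_uniq.
rewrite mem_undup; have -> : (u \in s) = (u \in [set` s]) :> Prop.
  by rewrite inE.
rewrite -sE inE; split => [[x Ex <-]|[x Ex ->]]; first by exists x.
by exists x.
Qed.

Lemma sum_le_Splus (R : realType) (N : nat) (s b : R) (E : set 'rV[R]_N)
    (r : seq (@dyadic N)) :
  uniq r -> (forall z, z \in r -> b <= beta E (dilate 3 z)) ->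
  (Splus s b E < +oo)%E ->
  \sum_(z <- r) diam (@cube R N z) `^ s <= fine (Splus s b E).
Proof.
move=> ur rb fS.
have : ((\sum_(z <- r) diam (@cube R N z) `^ s)%:E <= Splus s b E)%E.
  apply: esum_ge; exists [set` r].
    by split; [exact: finite_seq|move=> z /= zr; apply: rb].
  by rewrite -fsbig_seq // sumEFin.
by move: fS; case: (Splus s b E) => [S| |] //= _; rewrite lee_fin.
Qed.

(** With M = 2 ^ J, the weight of the tree is finite: the weight of the children
    of a flat cube is at most half of its own, because M * 6 ^ N <= M ^ s / 2;
    the other cubes are terms of the sum Splus. *)
Lemma tree_mass (R : realType) (N J : nat) (s : R) (E : set 'rV[R]_N)
    (k : int) (V : nat -> seq 'rV[int]_N) :
  let b := (3 * N%:R * (2 ^ J)%:R)^-1 in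
  let side n : R := 2 ^ (k - (n * J)%:Z) in
  (0 < N)%N -> (0 < J)%N -> 0 <= s ->
  2 * ((2 ^ J)%:R * 6 ^+ N) <= (2 ^ J)%:R `^ s ->
  (Splus s b E < +oo)%E ->
  (forall x y, E x -> E y -> forall i, `|x 0 i - y 0 i| <= 2 ^ k) ->
  (forall n, uniq (V n)) ->
  (forall n u, u \in V n <->
     exists2 x, E x & u = grid_index (k - (n * J)%:Z) x) ->
  forall L, \sum_(0 <= n < L) (size (V n))%:R * side n `^ s <=
    2 * (2 ^+ N * (2 ^ k) `^ s + (2 ^ J)%:R ^+ N * fine (Splus s b E)).
Proof.
move=> b side N0 J0 s0 Ms fS Ek uV VE.
set M : R := (2 ^ J)%:R in Ms *; set S := fine _.
have M1 : 1 <= M by rewrite /M natrX exprn_ege1 // ler1n.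
have M0 : 0 < M by rewrite (lt_le_trans ltr01).
have side0 n : 0 < side n by rewrite exprz_gt0.
have sideS n : side n = M * side n.+1.
  rewrite /side /M natrX exprnP -expfzDr ?pnatr_eq0 //; congr (_ ^ _).
  by rewrite mulSn PoszD; ring.
pose w n := side n `^ s.
have w0 n : 0 <= w n by apply: powR_ge0.
have wS n : w n = M `^ s * w n.+1.
  by rewrite /w sideS powRM // ltW.
have wS_le n : w n.+1 <= w n.
  rewrite (wS n) -[leLHS]mul1r ler_wpM2r //.
  rewrite -[leLHS](congr1 (@^~ s) (powR1 R)).
  by rewrite (ge0_ler_powR s0) ?nnegrE ?(ltW M0) ?ler01.
pose bad n (t : 'rV[int]_N) := b <= beta E (dilate 3 (k - (n * J)%:Z, t)).
pose mass n := (size (V n))%:R * w n.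
pose badmass n := \sum_(t <- V n | bad n t) w n.
have step n : mass n.+1 <= 2^-1 * mass n + M ^+ N * badmass n.
  rewrite /mass (@size_fibers _ _ (parent (2 ^ J)) _ (V n)) //; last first.
    move=> u /VE[x Ex ->]; apply/VE; exists x => //.
    rewrite parent_grid_index; congr grid_index.
    by rewrite mulSn PoszD; ring.
  rewrite natr_sum mulr_suml /badmass big_distrr /=.
  rewrite -[size (V n)]sum1_size natr_sum mulr_suml mulr_sumr.
  rewrite [X in _ <= _ + X]big_mkcond -big_split /=.
  apply: ler_sum => t _; rewrite mul1r.
  case: ifP => [_|/negbT].
    apply: (@le_trans _ _ (M ^+ N * w n)); last by rewrite lerDr mulr_ge0.
    rewrite ler_pM // /M -natrX ler_nat.
    apply: size_close; rewrite ?filter_uniq ?expn_gt0 // => u v.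
    rewrite !mem_filter => /andP[/eqP ut _] /andP[/eqP vt _].
    by apply: parent_close; rewrite ?expn_gt0 // ut.
  rewrite -ltNge addr0 => flat.
  have := @flat_children R N J E _ t [seq u <- V n.+1 | parent (2 ^ J) u == t]
    N0 flat (filter_uniq _ (uV _)).
  rewrite (wS n) => h; rewrite mulrA ler_wpM2r //.
  apply: (@le_trans _ _ (M * 6 ^+ N)).
    rewrite /M -natrX -natrM ler_nat; apply: h => u.
    rewrite mem_filter => /andP[/eqP ut /VE[x Ex ux]]; split=> //.
    exists x => //; rewrite ux; congr grid_index.
    by rewrite mulSn PoszD; ring.
  by rewrite ler_pdivlMl.
have badS L : \sum_(0 <= n < L) badmass n <= S.
  pose r := [seq z <- [seq (k - (n * J)%:Z, t) | n <- index_iota 0 L, t <- V n]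
            | b <= beta E (dilate 3 z)].
  have ur : uniq r.
    apply: filter_uniq; apply: allpairs_uniq_dep => //; first exact: iota_uniq.
    move=> [n t] [n' t'] _ _ /= [/addrI/oppr_inj[/eqP nn'] ->].
    by move: nn'; rewrite eqn_pmul2r // => /eqP ->.
  have rb z : z \in r -> b <= beta E (dilate 3 z).
    by rewrite mem_filter => /andP[].
  apply: le_trans (sum_le_Splus ur rb fS).
  rewrite /r big_filter [leRHS]big_mkcond big_allpairs_dep /=.
  apply: ler_sum => n _; rewrite /badmass big_mkcond; apply: ler_sum => t _.
  rewrite /bad; case: ifP => // _.
  have dc := @diam_cube_ge R N (k - (n * J)%:Z, t) N0.
  rewrite /w (ge0_ler_powR s0) ?nnegrE ?(ltW (side0 n)) //.
  by rewrite ltW // (lt_le_trans (side0 n)).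
have badS0 : 0 <= S by have := badS 0%N; rewrite big_geq.
have mass0 : mass 0%N <= 2 ^+ N * w 0%N.
  rewrite /mass ler_wpM2r // -natrX ler_nat.
  apply: size_close => // u v /VE[x Ex ->] /VE[y Ey ->] j.
  rewrite !mxE mul0n subr0; apply: (@floor_dist _ _ _ 1).
  rewrite -mulrBl normrM normfV (gtr0_norm (exprz_gt0 _ _)) //.
  by rewrite ler_pdivrMr ?exprz_gt0 // mul1r Ek.
have sum_mass L :
    \sum_(0 <= n < L.+1) mass n <= 2 * (mass 0%N + M ^+ N * S).
  have split0 : \sum_(0 <= n < L.+1) mass n =
    mass 0%N + \sum_(0 <= n < L) mass n.+1 by rewrite big_nat_recl.
  have : \sum_(0 <= n < L) mass n.+1 <=
      2^-1 * \sum_(0 <= n < L) mass n + M ^+ N * S.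
    apply: (@le_trans _ _ (2^-1 * \sum_(0 <= n < L) mass n +
      M ^+ N * \sum_(0 <= n < L) badmass n)).
      by rewrite !mulr_sumr -big_split; apply: ler_sum => n _; apply: step.
    by rewrite lerD2l ler_wpM2l // exprn_ge0 // ltW.
  have : \sum_(0 <= n < L) mass n <= \sum_(0 <= n < L.+1) mass n.
    by rewrite big_nat_recr //= lerDl mulr_ge0.
  lra.
move=> L; apply: (@le_trans _ _ (2 * (mass 0%N + M ^+ N * S))); last first.
  rewrite ler_wpM2l // lerD2r (le_trans mass0) //.
  by rewrite /w /side mul0n subr0.
apply: le_trans (sum_mass L).
by rewrite big_nat_recr //= lerDl mulr_ge0.
Qed.

(** * The Hölder curve *)

Lemma bounded_coord (R : realType) (N : nat) (E : set 'rV[R]_N) :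
  bounded_set E ->
  exists c, forall x y, E x -> E y -> forall i, `|x 0 i - y 0 i| <= c.
Proof.
move=> [M0 [_ EM0]]; set M := M0 + 1.
have EM := EM0 M (ltr_pwDr ltr01 (lexx M0)).
exists (M + M) => x y Ex Ey i.
have coord z : E z -> `|z 0 i| <= M.
  move=> /EM; apply: le_trans; rewrite [leRHS]mx_normrE.
  exact: (le_bigmax _ (fun ij => `|z ij.1 ij.2|) (0, i)).
by rewrite (le_trans (ler_normB _ _)) // lerD ?coord.
Qed.

(** A dyadic scale comparable to d. *)
Lemma exp2z_approx (R : realType) (d : R) :
  0 < d -> exists k : int, d <= 2 ^ k <= 2 * d.
Proof.
move=> d0; have l2 : 0 < ln (2 : R) by rewrite ln_gt0 // ltr1n.
have dE : d = 2 `^ (ln d / ln 2).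
  by rewrite /powR pnatr_eq0 /= divfK ?gt_eqF // lnK.
have [h1 h2] := andP (floor_itv (ln d / ln 2)).
set m := Num.floor _ in h1 h2; exists (m + 1).
have ge12 : 1 <= (2 : R) by rewrite ler1n.
apply/andP; split.
  by rewrite {1}dE -powR_intmul ?ler0n // ler_powR // ltW.
rewrite expfzDr ?pnatr_eq0 // expr1z mulrC ler_wpM2l ?ler0n //.
by rewrite [leRHS]dE -powR_intmul ?ler0n // ler_powR.
Qed.

(** Because s > 1, the factor (2 ^ J) ^ (s - 1) exceeds the constant 2 * 6 ^ N
    for J large. *)
Lemma flat_scale (R : realType) (N : nat) (s : R) :
  1 < s -> exists J : nat, (0 < J)%N /\
    2 * ((2 ^ J)%:R * 6 ^+ N) <= (2 ^ J)%:R `^ s :> R.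
Proof.
move=> s1; have s1' : 0 < s - 1 by rewrite subr_gt0.
pose n := (2 * 6 ^ N)%N; pose J := (Num.truncn (n%:R / (s - 1))).+1.
exists J; split => //.
have nJ : n%:R <= J%:R * (s - 1) by rewrite -ler_pdivrMr // ltW // truncnS_gt.
have M0 : (0 : R) < (2 ^ J)%:R by rewrite ltr0n expn_gt0.
rewrite -(mulr_powRB1 (ltW M0)) ?(lt_trans ltr01) //.
rewrite mulrCA ler_wpM2l ?(ltW M0) //.
have -> : (2 ^ J)%:R = 2 `^ J%:R :> R by rewrite natrX powR_mulrn ?ler0n.
rewrite -powRrM.
have ge12 : 1 <= (2 : R) by rewrite ler1n.
apply: (@le_trans _ _ (2 `^ n%:R)); last by rewrite ler_powR.
rewrite powR_mulrn ?ler0n // -!natrX -natrM ler_nat ltnW //.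
exact: ltn_expl.
Qed.

(** Distinct points are separated by the cubes of some level, and at the first
    such level the side of the cubes is at least 2 ^ - J times the distance in
    each coordinate: the points share a cube of the level before, if any. *)
Lemma separated_by_level (R : realType) (N J : nat) (k : int)
    (x y : 'rV[R]_N) :
  (0 < J)%N -> (forall i, `|x 0 i - y 0 i| <= 2 ^ k) ->
  x = y \/ exists n,
    grid_index (k - (n * J)%:Z) x <> grid_index (k - (n * J)%:Z) y /\
    forall i, `|x 0 i - y 0 i| <= (2 ^ J)%:R * 2 ^ (k - (n * J)%:Z).
Proof.
move=> J0 xyk.
have cube_le n :
    grid_index (k - (n * J)%:Z) x = grid_index (k - (n * J)%:Z) y ->
    forall i, `|x 0 i - y 0 i| <= 2 ^ (k - (n * J)%:Z).
  move=> e; apply: (cube_coord (q := (_, _)) (cube_grid_index _ x)).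
  by rewrite e; apply: cube_grid_index.
have [sep|nsep] := pselect (exists n,
    grid_index (k - (n * J)%:Z) x != grid_index (k - (n * J)%:Z) y).
  right; case: (ex_minnP sep) => n /eqP nxy nmin; exists n; split => // i.
  case: n nxy nmin => [|n] nxy nmin.
    rewrite mul0n subr0; apply: le_trans (xyk i) _.
    by rewrite -[leLHS]mul1r ler_wpM2r ?ler1n ?expn_gt0 // exprz_ge0.
  rewrite natrX exprnP -expfzDr ?pnatr_eq0 //.
  rewrite (_ : _ + _ = k - (n * J)%:Z); last by rewrite mulSn PoszD; ring.
  apply: cube_le; apply/eqP; apply: contraT => /nmin.
  by rewrite ltnn.
left; apply/rowP => i; apply/eqP; apply: contra_notT nsep => xy.
have e0 : 0 < `|x 0 i - y 0 i| by rewrite normr_gt0 subr_eq0.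
pose n := (Num.truncn (2 ^ k / `|x 0 i - y 0 i|)).+1.
exists n; apply/eqP => /cube_le/(_ i).
rewrite expfzDr ?pnatr_eq0 // -exprnN; apply/negP.
rewrite -ltNge ltr_pdivrMr ?exprn_gt0 // mulrC -ltr_pdivrMr //.
apply: lt_le_trans (truncnS_gt _) _; rewrite -/n -natrX ler_nat.
apply: leq_trans (ltnW (ltn_expl n (ltnSn 1))) _.
by rewrite leq_exp2l // leq_pmulr.
Qed.

Lemma holder_bound (R : realType) (s A d S W : R) :
  1 <= s -> 0 < d -> 0 <= S -> 0 <= A -> 0 <= W -> W <= A * (d `^ s + S) ->
  W `^ s^-1 <= A `^ s^-1 * (d + d `^ (1 - s) * S).
Proof.
move=> s1 d0 S0 A0 W0 WA; have s0 : 0 < s by lra.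
have r0 : 0 <= s^-1 by rewrite invr_ge0 ltW.
have ds0 : 0 < d `^ s by rewrite powR_gt0.
have X0 : 0 <= S / d `^ s by rewrite divr_ge0 // ltW.
apply: (@le_trans _ _ ((A * (d `^ s + S)) `^ s^-1)).
  by rewrite (ge0_ler_powR r0) ?nnegrE ?mulr_ge0 ?addr_ge0 ?powR_ge0.
rewrite powRM ?addr_ge0 ?powR_ge0 // ler_wpM2l ?powR_ge0 //.
have -> : d `^ s + S = d `^ s * (1 + S / d `^ s).
  by rewrite mulrDr mulr1 mulrCA divff ?gt_eqF // mulr1.
have -> : d + d `^ (1 - s) * S = d * (1 + S / d `^ s).
  rewrite powRB; last by rewrite (gt_eqF d0) implybT.
  by rewrite powRr1 ?(ltW d0) //; field; rewrite gt_eqF.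
rewrite powRM ?(ltW ds0) ?addr_ge0 // -powRrM divff ?gt_eqF //.
rewrite powRr1 ?(ltW d0) //.
by rewrite ler_pM2l // ler1_powR ?invf_le1 // lerDl.
Qed.

Theorem theorem1p1 (R : realType) (N : nat) (s : R) (hN : (2 <= N)%N)
    (hs : 1 < s) :
  exists beta0 : R, 0 < beta0 < 1 /\
  exists C : R, forall E : set 'rV[R]_N,
    E !=set0 -> bounded_set E -> (Splus s beta0 E < +oo)%E ->
    exists (f : R -> 'rV[R]_N) (H : R),
      [/\ holder_on01 s^-1 H f,
          E `<=` f @` `[0, 1] &
          H <= C * (diam E + diam E `^ (1 - s) * fine (Splus s beta0 E))].
Proof.
have [J [J0 Ms]] := flat_scale N hs.
have N0 : (0 < N)%N by apply: ltnW.
have s0 : 0 < s by apply: lt_trans hs.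
set M : R := (2 ^ J)%:R in Ms.
have M1 : 1 <= M by rewrite ler1n expn_gt0.
have M0 : 0 < M by apply: lt_le_trans M1.
have N2 : 2 <= N%:R :> R by rewrite ler_nat.
exists (3 * N%:R * M)^-1; split.
  have D1 : 1 < 3 * N%:R * M by nra.
  have D0 : 0 < 3 * N%:R * M by apply: lt_trans D1.
  by rewrite invr_gt0 D0 invf_lt1.
pose A := 2 * (2 ^+ N * 2 `^ s + M ^+ N).
exists (N%:R * (M * A `^ s^-1)) => E E0 Eb fS.
have [c Ec] := bounded_coord Eb.
have Ed x y : E x -> E y -> forall i, `|x 0 i - y 0 i| <= diam E.
  move=> Ex Ey i; apply: le_trans (enorm_sub_le_diam Ec Ex Ey).
  by apply: le_trans (coord_le_enorm _ i); rewrite !mxE.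
have [x0 Ex0] := E0.
have : 0 <= diam E by apply: le_trans (Ed _ _ Ex0 Ex0 (Ordinal N0)).
rewrite le_eqVlt => /orP[/eqP d0|d0].
  (* E is a single point. *)
  exists (fun _ => x0), 0; split.
  - move=> x y _ _; rewrite mul0r subrr -(mulr0 N%:R); apply: enorm_le => i.
    by rewrite mxE normr0.
  - move=> x Ex; exists 0; first by rewrite /= in_itv /= lexx ler01.
    apply/rowP => i; apply/eqP; rewrite -subr_eq0 -normr_le0.
    by have := Ed _ _ Ex0 Ex i; rewrite -d0.
  - by rewrite -d0 powR0 ?mul0r ?addr0 ?mulr0 // subr_eq0 lt_eqF.
have [k /andP[dk kd]] := exp2z_approx d0.
have Ek x y : E x -> E y -> forall i, `|x 0 i - y 0 i| <= 2 ^ k.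
  by move=> Ex Ey i; apply: le_trans (Ed _ _ Ex Ey i) dk.
have [V VP] := choice (fun n => grid_index_seq (k - (n * J)%:Z) Ec).
have mass := tree_mass N0 J0 (ltW s0) Ms fS Ek
  (fun n => proj1 (VP n)) (fun n => proj2 (VP n)).
set S := fine _ in mass *.
set W := 2 * _ in mass.
have S0 : 0 <= S.
  by rewrite fine_ge0 // esum_ge0 // => q _; rewrite lee_fin powR_ge0.
have k0 n : (0 : R) < 2 ^ (k - (n * J)%:Z) by rewrite exprz_gt0.
have W0 : 0 < W.
  rewrite mulr_gt0 // ltr_wpDr ?mulr_ge0 ?exprn_ge0 ?(ltW M0) //.
  by rewrite mulr_gt0 ?exprn_gt0 ?powR_gt0 ?exprz_gt0.
have [||||tau [tau0W tau_sep]] := @tree_coding R _ E _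
  (fun n => grid_index (k - (n * J)%:Z))
  (fun n => (2 ^ (k - (n * J)%:Z)) `^ s) V W.
- by move=> n; apply: powR_ge0.
- by move=> n x Ex; apply/(proj2 (VP n)); exists x.
- move=> n x y /(congr1 (parent (2 ^ J))); rewrite !parent_grid_index.
  by rewrite (_ : _ + _ = k - (n * J)%:Z) // mulSn PoszD; ring.
- exact: mass.
have r01 : 0 < s^-1 <= 1 by rewrite invr_gt0 s0 invf_le1 // ltW.
have [|x Ex|x y Ex Ey i|f [fH fE]] := @holder_curve R N E
  (fun x => tau x / W) (M * W `^ s^-1) s^-1 E0 r01.
- by rewrite mulr_ge0 ?powR_ge0 // ltW.
- by rewrite ler_pdivlMr // mul0r ler_pdivrMr // mul1r.
- rewrite -mulrBl normrM normfV (gtr0_norm W0) -mulrA.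
  rewrite -powRM ?divr_ge0 ?(ltW W0) // mulrCA divff ?gt_eqF // mulr1.
  have [->|[n [nxy xyn]]] := separated_by_level J0 (Ek x y Ex Ey).
    by rewrite subrr normr0 mulr_ge0 ?powR_ge0 // ltW.
  apply: le_trans (xyn i) _; rewrite ler_wpM2l ?(ltW M0) //.
  rewrite -[leLHS]powRr1 ?(ltW (k0 n)) //.
  rewrite -[X in _ `^ X <= _](divff (lt0r_neq0 s0)) powRrM.
  rewrite ge0_ler_powR ?nnegrE ?powR_ge0 ?invr_ge0 ?(ltW s0) //.
  exact: tau_sep.
exists f, (N%:R * (M * W `^ s^-1)); split => //.
rewrite -!mulrA ler_wpM2l ?ler0n // ler_wpM2l ?(ltW M0) //.
apply: holder_bound => //; rewrite ?(ltW hs) ?(ltW W0) //.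
  by rewrite mulr_ge0 ?addr_ge0 ?mulr_ge0 ?exprn_ge0 ?powR_ge0 ?(ltW M0).
rewrite /W /A -mulrA ler_wpM2l // mulrDl lerD //.
  rewrite -mulrA ler_wpM2l ?exprn_ge0 //.
  apply: (@le_trans _ _ (2 `^ s * diam E `^ s)).
    rewrite -powRM ?(ltW d0) // (ge0_ler_powR (ltW s0)) ?nnegrE ?mulr_ge0 //.
      exact: exprz_ge0.
    exact: ltW.
  by rewrite ler_wpM2l ?powR_ge0 // lerDl.
by rewrite ler_wpM2l ?exprn_ge0 ?(ltW M0) // lerDr powR_ge0.
Qed.
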